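(* Let $r$ and $s$ be positive integers with $r \geq s \geq 3$, $r \leq 2s - 2$ and $\gcd(r,s) > 1$. If $r < s + \frac{s}{\gcd(r,s)} - 1$, then $f(s,r,\mathbb{Z}) = 5s + \frac{s}{\gcd(r,s)} - 4$.
   Context: For integers $a\le b$, $[a,b]=\{n\in\mathbb{N} : a\le n\le b\}$. For a finite set $X\subseteq\mathbb{N}$, $\mathrm{diam}(X)=\max(X)-\min(X)$. Given a coloring $\Delta:[1,n]\to\mathbb{Z}$, a subset $Y$ is zero-sum mod $m$ if $\sum_{y\in Y}\Delta(y)\equiv 0 \pmod m$. $f(s,r,\mathbb{Z})$ denotes the smallest positive integer $n$ such that for every coloring $\Delta:[1,n]\to\mathbb{Z}$ there exist subsets $S_1,S_2\subseteq[1,n]$ with: (a) $S_1$ zero-sum mod $s$ and $S_2$ zero-sum mod $r$; (b) $|S_1|=s$, $|S_2|=r$; (c) $\max(S_1)<\min(S_2)$; (d) $\mathrm{diam}(S_1)\le\mathrm{diam}(S_2)$. *)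

(* Defs.v *)
From mathcomp Require Export all_boot all_order all_algebra finmap.

Set Implicit Arguments.
Unset Strict Implicit.
Unset Printing Implicit Defensive.

Local Open Scope fset_scope.

Definition interval (a b : nat) : {fset nat} := [fset n in iota a (b.+1 - a)].

Definition fmax (X : {fset nat}) : nat := \max_(x <- X) x.

(* Starting the iterated minimum at [fmax X] gives min(X) for every nonempty X. *)
Definition fmin (X : {fset nat}) : nat := \big[minn/fmax X]_(x <- X) x.

Definition diam (X : {fset nat}) : nat := fmax X - fmin X.

Definition zero_sum (m : nat) (Delta : nat -> int) (Y : {fset nat}) : Prop :=
  ((\sum_(y <- Y) Delta y)%R = 0 %[mod m%:Z])%Z.

(* A coloring of [1,n] is given by a function on nat, of which only the values
   on [1,n] are used, as S1 and S2 are subsets of [1,n]. *)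
Definition good (s r n : nat) : Prop :=
  forall Delta : nat -> int,
  exists S1 S2 : {fset nat},
    [/\ S1 `<=` interval 1 n /\ S2 `<=` interval 1 n,
        zero_sum s Delta S1 /\ zero_sum r Delta S2,
        #|` S1| = s /\ #|` S2| = r,
        fmax S1 < fmin S2
      & diam S1 <= diam S2].

(* [is_f s r n] means f(s,r,Z) = n. *)
Definition is_f (s r n : nat) : Prop :=
  [/\ 0 < n, good s r n & forall m, 0 < m -> good s r m -> n <= m].

(* Main.v *)
(* Write g = gcd(r, s), k = s / g and n = 5s + k - 4.

   Upper bound. Erdos-Ginzburg-Ziv gives a zero-sum s-set inside [1, 2s-1], of
   diameter at most D = 2s - 2.  The remaining interval [2s, n] has D + l elements,
   l = s + k - 1 > r.  Suppose that it contains no zero-sum r-set of diameter at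
   least D.  Take a smallest subgroup K of Z/r one of whose cosets misses at most
   r / #|K| of these elements.  By minimality the subset sums of the elements in the
   coset, translated by their most frequent value, fill K; a minimal representation
   of the wanted sum is zero-sum free, hence short, and can be completed to the
   wanted size by short zero-sum sets (Scherk's theorem) and by copies of the most
   frequent value.  This produces a forbidden r-set unless K = Z/r and, for each pair
   i, j at distance at least D, the other elements have only two colours, whose sum
   is that of i and j.  Comparing pairs with a common end, the first l and the
   last l elements are then constant mod r.  So the first l contain a zero-sum s-set,
   by Erdos-Ginzburg-Ziv in Z/k, and the last l a zero-sum r-set of diameter l - 1.

   Lower bound. The colouring of [1, n - 1] with consecutive blocks
   1^(s-k+1) 0^(s-1) 1^(s-1) (1+q)^(k-1) 1^(s-1) 0^(s+k-2), where q = 0 mod r and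
   q = -g mod s, has no such pair. *)

Require Import Defs.
From mathcomp Require Import all_boot all_order all_algebra finmap.
From mathcomp Require Import all_fingroup cyclic zify.

Set Implicit Arguments.
Unset Strict Implicit.
Unset Printing Implicit Defensive.

Import GRing.Theory FinRing.Theory.

(** * Sumsets in a finite abelian group and Scherk's theorem *)

Section SumSets.

Local Open Scope ring_scope.

Variable V : finZmodType.
Implicit Types (A B S : {set V}) (J K : {group V}) (x y : V).

Definition sumset A B : {set V} := [set a + b | a in A, b in B].

Lemma mem_sumset A B x y : x \in A -> y \in B -> x + y \in sumset A B.
Proof. by move=> xA yB; apply/imset2P; exists x y. Qed.

Lemma groupDr J x y : x \in J -> y \in J -> x + y \in J.
Proof. by move=> xJ yJ; rewrite -zmodMgE groupM. Qed.

Lemma groupNr J x : x \in J -> - x \in J.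
Proof. by move=> xJ; rewrite -zmodVgE groupV. Qed.

Lemma group0r J : 0 \in J.
Proof. by rewrite -zmod1gE group1. Qed.

Lemma mulrn_card x : x *+ #|V| = 0.
Proof. by rewrite -zmodXgE -cardsT expg_cardG ?inE. Qed.

(* Dyson's transform moves mass from [B] to [A] and keeps [0] uniquely represented. *)
Lemma scherk A B : 0 \in A -> 0 \in B ->
  (forall x y, x \in A -> y \in B -> x + y = 0 -> y = 0) ->
  (#|A| + #|B| <= #|sumset A B| + 1)%N.
Proof.
move En: #|B| => n; elim/ltn_ind: n => n IH in A B En *.
move=> A0 B0 uniq0; rewrite -En.
have [leB1|gtB1] := leqP #|B| 1.
  apply: leq_add leB1; apply: subset_leq_card; apply/subsetP=> x xA.
  by rewrite -(addr0 x) mem_sumset.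
have [b bB bn0] : exists2 b, b \in B & b != 0.
  have /card_gt0P[b] : (0 < #|B :\ 0%R|)%N.
    by move: gtB1; rewrite (cardsD1 (0 : V) B) B0.
  by rewrite !inE => /andP[bn0 bB]; exists b.
(* Otherwise translation by [b] would map [A] onto itself, so [x + b = 0] for some [x] in [A], and
   uniqueness would force [b = 0]. *)
have [e eA eB] : exists2 e, e \in A & [exists b in B, e + b \notin A].
  apply/exists_inP; rewrite -[X in is_true X]negbK; apply/negP.
  rewrite negb_exists_in => /forall_inP noE.
  have stab x : x \in A -> x + b \in A.
    move=> xA; have := noE x xA; rewrite negb_exists_in => /forall_inP/(_ b bB).
    by rewrite negbK.
  have AbE : [set x + b | x in A] = A.
    apply/eqP; rewrite eqEcard card_imset ?leqnn ?andbT; last exact: addIr.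
    by apply/subsetP=> _ /imsetP[x xA ->]; apply: stab.
  move: A0; rewrite -AbE => /imsetP[x xA /esym xb0].
  by case/eqP: bn0; apply: uniq0 xA bB xb0.
pose B' := [set y in B | e + y \in A].
pose A' := A :|: [set e + y | y in B :\: B'].
have cardA' : #|A'| = (#|A| + #|B :\: B'|)%N.
  rewrite /A' cardsU (_ : A :&: _ = set0) ?cards0 ?subn0.
    by rewrite card_imset //; apply: addrI.
  apply/setP=> x; rewrite !inE; apply/negbTE/negP => /andP[xA /imsetP[y]].
  by rewrite !inE => /andP[+ yB] xE; rewrite yB -xE xA.
have sB'B : B' \subset B by apply/subsetP=> y; rewrite inE => /andP[].
have cardB' : (#|B'| + #|B :\: B'|)%N = #|B|.
  by rewrite -(cardsID B' B) (setIidPr sB'B).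
have ltB' : (#|B'| < n)%N.
  rewrite -En; apply: proper_card; apply/properP; split=> //.
  by case/exists_inP: eB => y yB eyA; exists y => //; rewrite inE yB.
(* No new sum arises: [(e + b1) + y] regroups as [(e + y) + b1], where [e + y] is in [A] by the
   choice of [B']. *)
have subAB x y : x \in A' -> y \in B' ->
    exists x' y', [/\ x' \in A, y' \in B, x + y = x' + y' &
      (x' + y' = 0 -> y = 0)].
  move=> + /setIdP[yB eyA] => /setUP[xA|/imsetP[b1 /setDP[b1B _] ->]].
    by exists x, y; split=> // ?; apply: (uniq0 x).
  exists (e + y), b1; split=> //.
    by rewrite addrAC.
  move=> z0; have b10 := uniq0 _ _ eyA b1B z0.
  by apply: (uniq0 e) => //; rewrite -z0 b10 addr0.
have A'0 : 0 \in A' by rewrite inE A0.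
have B'0 : 0 \in B' by rewrite inE B0 addr0.
have uniq0' x y : x \in A' -> y \in B' -> x + y = 0 -> y = 0.
  by move=> xA yB; have [x' [y' [_ _ -> h]]] := subAB x y xA yB.
have := IH _ ltB' A' B' erefl A'0 B'0 uniq0'.
suff : (#|sumset A' B'| <= #|sumset A B|)%N by lia.
apply: subset_leq_card; apply/subsetP=> _ /imset2P[x y xA yB ->].
by have [x' [y' [x'A y'B -> _]]] := subAB x y xA yB; apply: mem_sumset.
Qed.

End SumSets.

(** * Subset sums, their periods, and zero-sum free sets *)

Section SubsetSums.

Local Open Scope ring_scope.

Variables (V : finZmodType) (I : finType) (c : I -> V).
Implicit Types (T U W : {set I}) (J K : {group V}) (x y : V).

Local Notation ssum U := (\sum_(i in (U : {set I})) c i).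

Definition sums T : {set V} := [set ssum U | U : {set I} in powerset T].

Lemma sumsP T x : reflect (exists2 U : {set I}, U \subset T & x = ssum U) (x \in sums T).
Proof.
apply: (iffP imsetP) => [[U]|[U sUT ->]]; last by exists U; rewrite ?inE.
by rewrite inE => sUT ->; exists U.
Qed.

Lemma sums0 T : 0 \in sums T.
Proof. by apply/sumsP; exists set0; rewrite ?sub0set ?big_set0. Qed.

Lemma ssumU U W : [disjoint U & W] -> ssum (U :|: W) = ssum U + ssum W.
Proof. by move=> dis; rewrite (eq_bigl [predU U & W]) ?bigU //= => i; rewrite inE. Qed.

Lemma ssumD U W : W \subset U -> ssum (U :\: W) = ssum U - ssum W.
Proof. by move=> sWU; rewrite [in RHS](big_setID W) /= (setIidPr sWU) addrAC subrr add0r. Qed.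

Lemma sums_group T K : (forall i, i \in T -> c i \in K) -> sums T \subset K.
Proof.
move=> cK; apply/subsetP=> _ /sumsP[U /subsetP sUT ->].
apply: (big_ind (fun x => x \in K)) => [|x y|i iU]; first exact: group0r.
  exact: groupDr.
exact/cK/sUT.
Qed.

Lemma sumsU1 T i : i \notin T ->
  sums (i |: T) = sums T :|: [set c i + x | x in sums T].
Proof.
move=> iT; apply/setP=> x; rewrite inE; apply/sumsP/orP.
  case=> U sU ->; have [iU|iU] := boolP (i \in U).
    right; rewrite (big_setD1 i) //= imset_f //; apply/sumsP.
    by exists (U :\ i) => //; rewrite subDset.
  left; apply/sumsP; exists U => //; apply/subsetP=> j jU.
  have := subsetP sU j jU; rewrite !inE => /orP[/eqP ji|//].
  by rewrite ji (negPf iU) in jU.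
case=> [/sumsP[U sU ->]|/imsetP[_ /sumsP[U sU ->] ->]].
  by exists U => //; apply: subset_trans sU (subsetUr _ _).
exists (i |: U); first by rewrite setUS.
by rewrite big_setU1 //=; apply: contra iT => /(subsetP sU).
Qed.

Lemma sumsS T U : T \subset U -> sums T \subset sums U.
Proof.
move=> sTU; apply/subsetP=> _ /sumsP[W sW ->].
by apply/sumsP; exists W => //; apply: subset_trans sTU.
Qed.

(* Stabilizers only grow along [T], so adding an element outside [J] to an
   exactly [J]-periodic sum set gains a full coset of [J]. *)
Lemma card_sums_periodic T J :
  (forall x, (forall y, y \in sumset (sums T) J -> x + y \in sumset (sums T) J) ->
     x \in J) ->
  ((#|[set i in T | c i \notin J]| + 1) * #|J| <= #|sumset (sums T) J|)%N.
Proof.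
move En: #|T| => n; elim: n T En => [|n IH] T En stabJ.
  have -> : [set i in T | c i \notin J] = set0.
    by apply/setP=> i; rewrite (cards0_eq En) !inE.
  rewrite cards0 add0n mul1n; apply: subset_leq_card; apply/subsetP=> x xJ.
  by rewrite -(add0r x) mem_sumset ?sums0.
have /card_gt0P[i iT] : (0 < #|T|)%N by rewrite En.
pose T' := T :\ i; have TE : T = i |: T' by rewrite setD1K.
have iT' : i \notin T' by rewrite !inE eqxx.
have ET' : #|T'| = n by have := cardsD1 i T; rewrite iT En /T'; lia.
set P := sumset (sums T') J.
have PE : sumset (sums T) J = P :|: [set c i + x | x in P].
  apply/setP=> x; rewrite TE inE; apply/imset2P/orP.
    case=> y j + jJ ->; rewrite sumsU1 // inE => /orP[yT|/imsetP[w wT ->]].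
      by left; apply: mem_sumset.
    by right; rewrite -addrA imset_f // mem_sumset.
  case=> [/imset2P[y j yT jJ ->]|/imsetP[_ /imset2P[y j yT jJ ->] ->]].
    by exists y j; rewrite // sumsU1 // inE yT.
  by exists (c i + y) j; rewrite ?addrA // sumsU1 // inE orbC imset_f.
have stab' x : (forall y, y \in P -> x + y \in P) -> x \in J.
  move=> st; apply: stabJ => y; rewrite PE !inE => /orP[/st->//|/imsetP[w wP ->]].
  by apply/orP; right; rewrite addrCA imset_f // st.
have := IH T' ET' stab'; rewrite -/P PE => leP.
have [ciJ|ciJ] := boolP (c i \in J).
  have -> : [set i in T | c i \notin J] = [set i in T' | c i \notin J].
    apply/setP=> k; rewrite !inE; have [->|] := eqVneq k i; last by [].
    by rewrite ciJ !andbF.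
  by apply: leq_trans leP _; apply: subset_leq_card; apply: subsetUl.
have -> : [set i in T | c i \notin J] = i |: [set i in T' | c i \notin J].
  apply/setP=> k; rewrite !inE; have [->|] := eqVneq k i; last by [].
  by rewrite iT.
rewrite cardsU1 !inE eqxx /= -addnA mulnDl mul1n addnC.
apply: leq_trans (leq_add leP (leqnn _)) _.
(* As [c i] is not in [J], it is not a period of [P], so translation by it leaves [P] somewhere;
   with [y], a whole coset of [J] is gained. *)
have [y yP cyP] : exists2 y, y \in P & c i + y \notin P.
  apply/exists_inP; rewrite -[X in is_true X]negbK; apply/negP.
  rewrite negb_exists_in => /forall_inP st.
  by case/negP: ciJ; apply: stab' => y /st; rewrite negbK.
have perP w j : w \in P -> j \in J -> w + j \in P.
  case/imset2P=> a b aT bJ -> jJ; rewrite -addrA mem_sumset //.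
  exact: groupDr.
pose C := [set c i + y + j | j in J].
have cardC : #|C| = #|J| by rewrite card_imset //; apply: addrI.
rewrite -cardC -(cardsID P (P :|: _)); apply: leq_add; apply: subset_leq_card.
  by apply/subsetP=> w wP; rewrite !inE wP.
apply/subsetP=> _ /imsetP[j jJ ->]; rewrite !inE; apply/andP; split.
  by apply: contra cyP => /perP/(_ (groupNr jJ)); rewrite addrK.
by rewrite orbC -addrA imset_f // perP.
Qed.

(** Let [J] be the group of periods of [sums T]; it lies in [sums T] because [0] does. If [J] is not
    [K], the bound for periodic sum sets and the hypothesis on [J] give at least [#|K|] sums, all in
    [K]. *)
Lemma sums_full T K : (forall i, i \in T -> c i \in K) ->
  (forall J, J \proper K ->
     (#|K| <= (#|[set i in T | c i \notin J]| + 1) * #|J|)%N) ->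
  K \subset sums T.
Proof.
move=> cK hyp; have sTK := sums_group cK.
pose st := [set x | [forall y in sums T, x + y \in sums T]].
have stP x : reflect (forall y, y \in sums T -> x + y \in sums T) (x \in st).
  by rewrite inE; apply: forall_inP.
have gst : group_set st.
  apply/group_setP; split=> [|x y /stP xs /stP ys].
    by apply/stP=> y; rewrite zmod1gE add0r.
  by apply/stP=> z zT; rewrite zmodMgE -addrA xs ?ys.
pose J := Group gst.
have sJT : J \subset sums T.
  by apply/subsetP=> x /stP/(_ 0 (sums0 T)); rewrite addr0.
have [JK|nJK] := eqVneq (J : {set V}) K; first by rewrite -JK.
have pJK : J \proper K.
  by rewrite properEneq nJK; apply: subset_trans sJT sTK.
have TE : sumset (sums T) J = sums T.
  apply/setP=> x; apply/imset2P/idP => [[y j yT /stP jJ ->]|xT].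
    by rewrite addrC jJ.
  by exists x 0; rewrite ?addr0 // group0r.
have leT : ((#|[set i in T | c i \notin J]| + 1) * #|J| <= #|sums T|)%N.
  by have := @card_sums_periodic T J; rewrite TE; apply=> x st'; apply/stP.
have leK := leq_trans (hyp J pJK) leT.
suff -> : sums T = K by [].
by apply/eqP; rewrite eqEcard sTK.
Qed.

Definition zero_free T := forall U, U \subset T -> ssum U = 0 -> U = set0.

Lemma zero_freeS T U : U \subset T -> zero_free T -> zero_free U.
Proof. by move=> sUT zT W sW; apply: zT; apply: subset_trans sUT. Qed.

(** Every further element [i] brings a new sum: if translation by [c i] permuted the previous sums,
    [0] would be [c i] plus one of them, a nonempty zero sum. *)
Lemma card_sums_zero_free U T : U \subset T -> zero_free T ->
  (#|sums U| + #|T :\: U| <= #|sums T|)%N.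
Proof.
move En: #|T :\: U| => n; elim: n T En => [|n IH] T En sUT zT.
  by rewrite addn0; apply: subset_leq_card; apply: sumsS.
have /card_gt0P[i iTU] : (0 < #|T :\: U|)%N by rewrite En.
have [iU iT] : i \notin U /\ i \in T by move: iTU; rewrite inE => /andP.
pose T' := T :\ i; have TE : T = i |: T' by rewrite setD1K.
have iT' : i \notin T' by rewrite !inE eqxx.
have sUT' : U \subset T' by rewrite subsetD1 sUT.
have sT'T : T' \subset T by apply: subD1set.
have ET' : #|T' :\: U| = n.
  have := cardsD1 i (T :\: U); rewrite iTU En.
  suff -> : T' :\: U = (T :\: U) :\ i by lia.
  by rewrite /T' !setDDl setUC.
have := IH T' ET' sUT' (zero_freeS sT'T zT).
suff : (#|sums T'| < #|sums T|)%N by lia.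
rewrite TE sumsU1 //; apply: proper_card; apply/properP.
split; first exact: subsetUl.
have [/subsetP st|/subsetPn[x xS xT]] :=
    boolP ([set c i + x | x in sums T'] \subset sums T'); last first.
  by exists x; rewrite // inE xS orbT.
have stE : [set c i + x | x in sums T'] = sums T'.
  apply/eqP; rewrite eqEcard; apply/andP; split; first exact/subsetP.
  by rewrite [leqRHS]card_imset ?leqnn //; apply: addrI.
have := sums0 T'; rewrite -stE => /imsetP[_ /sumsP[W sW ->] /esym z0].
have iW : i \notin W by apply: contra iT' => /(subsetP sW).
have /zT W0 : i |: W \subset T by rewrite TE setUS.
have {}W0 : i |: W = set0 by apply: W0; rewrite big_setU1.
by have := setU11 i W; rewrite W0 inE.
Qed.

Lemma zero_free_card T : zero_free T -> (#|T| < #|sums T|)%N.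
Proof.
move=> zT; have := card_sums_zero_free (sub0set T) zT; rewrite setD0.
suff : (0 < #|sums set0|)%N by lia.
by apply/card_gt0P; exists 0; apply: sums0.
Qed.

(** The pair alone has the four sums [0], [c i], [c j], [c i + c j], one more than the general
    bound; each other element adds at least one. *)
Lemma zero_free_card2 T i j : i \in T -> j \in T -> c i != c j ->
  zero_free T -> (#|T| + 1 < #|sums T|)%N.
Proof.
move=> iT jT cij zT; have nij : i != j by apply: contraNneq cij => ->.
have sijT : [set i; j] \subset T.
  by apply/subsetP=> k; rewrite !inE => /orP[/eqP->|/eqP->].
have zij := zero_freeS sijT zT.
have := card_sums_zero_free sijT zT; have := cardsID [set i; j] T.
rewrite (setIidPr sijT) cards2 nij.
suff : (4 <= #|sums [set i; j]|)%N by lia.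
have nz W k : W \subset [set i; j] -> k \in W -> ssum W != 0.
  by move=> /zij zW kW; apply/eqP=> /zW W0; rewrite W0 inE in kW.
have ni0 : c i != 0.
  by have := nz [set i] i (subsetUl _ _) (set11 i); rewrite big_set1.
have nj0 : c j != 0.
  by have := nz [set j] j (subsetUr _ _) (set11 j); rewrite big_set1.
have nij0 : c i + c j != 0.
  have := nz [set i; j] i (subxx _) (setU11 _ _).
  by rewrite big_setU1 ?inE //= big_set1.
have -> : 4%N = #|[set x in [:: 0; c i; c j; c i + c j]]|.
  rewrite cardsE; apply/esym/card_uniqP; rewrite /= !inE !negb_or.
  rewrite ![0 == _]eq_sym ni0 nj0 nij0 cij /= -{1}(addr0 (c i)) (inj_eq (addrI _)).
  by rewrite eq_sym nj0 -{1}(add0r (c j)) (inj_eq (addIr _)) eq_sym ni0.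
apply: subset_leq_card; apply/subsetP=> x; rewrite !inE => xE; apply/sumsP.
case/or4P: xE => /eqP->.
- by exists set0; rewrite ?sub0set ?big_set0.
- by exists [set i]; rewrite ?subsetUl ?big_set1.
- by exists [set j]; rewrite ?subsetUr ?big_set1.
- by exists [set i; j]; rewrite // big_setU1 ?inE //= big_set1.
Qed.

End SubsetSums.

Lemma exists_subset_card (I : finType) (A : {set I}) k : (k <= #|A|)%N ->
  exists2 B : {set I}, B \subset A & #|B| = k.
Proof.
rewrite -bin_gt0 -cards_draws => /card_gt0P[B].
by rewrite inE => /andP[sBA /eqP cB]; exists B.
Qed.

(** * Short zero-sum sets *)

Section ShortSums.

Local Open Scope ring_scope.

Variables (V : finZmodType) (I : finType) (c : I -> V).
Implicit Types (T U W R : {set I}) (J K : {group V}) (x y : V).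

Local Notation ssum U := (\sum_(i in (U : {set I})) c i).

Definition mult T x := #|[set i in T | c i == x]|.

Lemma sum_set1U U i : i \notin U -> ssum (i |: U) = c i + ssum U.
Proof. by move=> iU; rewrite big_setU1. Qed.

Definition short_sums h T : {set V} :=
  [set ssum U | U : {set I} in powerset T & (#|U| <= h)%N].

Lemma short_sumsP h T x :
  reflect (exists U : {set I}, [/\ U \subset T, (#|U| <= h)%N & x = ssum U])
          (x \in short_sums h T).
Proof.
apply: (iffP imsetP) => [[U]|[U [sUT leU ->]]].
  by rewrite !inE => /andP[sUT leU] ->; exists U.
by exists U; rewrite // !inE sUT.
Qed.

(** Induction on [h]: removing one representative of each value lowers all multiplicities. Scherk's
    theorem is applied to the short sums of the rest and to the removed values together with [0];
    its uniqueness hypothesis is the absence of short zero sums. *)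
Lemma card_short_sums h R : (forall x, mult R x <= h)%N ->
  (forall W, W \subset R -> (#|W| <= h)%N -> ssum W = 0 -> W = set0) ->
  (#|R| < #|short_sums h R|)%N.
Proof.
elim: h R => [|h IH] R multR zR.
  have -> : R = set0.
    apply/setP=> i; rewrite inE; apply/negP=> iR.
    have := multR (c i); rewrite leqn0 cards_eq0 => /eqP/setP/(_ i).
    by rewrite !inE iR eqxx.
  rewrite cards0; apply/card_gt0P; exists 0; apply/short_sumsP.
  by exists set0; rewrite sub0set cards0 big_set0.
(* The [pick] depends only on the value [c i], so [A] holds exactly one index for each value. *)
pose A := [set i in R | [pick j in R | c j == c i] == Some i].
have sAR : A \subset R by apply/subsetP=> i /setIdP[].
have injA : {in A &, injective c}.
  move=> i j /setIdP[_ /eqP pi] /setIdP[_ /eqP pj] cij.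
  by apply: Some_inj; rewrite -pi -pj; apply: eq_pick => k /=; rewrite cij.
have surjA i : i \in R -> exists2 j, j \in A & c j = c i.
  move=> iR; case E: [pick j in R | c j == c i] => [j|]; last first.
    by move: E; case: pickP => // /(_ i); rewrite /= iR eqxx.
  have /andP[jR /eqP cji] : (j \in R) && (c j == c i).
    by move: E; case: pickP => // k Pk [<-].
  exists j => //; rewrite inE jR -E; apply/eqP.
  by apply: eq_pick => k /=; rewrite cji.
pose R' := R :\: A.
have sR'R : R' \subset R by apply: subsetDl.
have multR' x : (mult R' x <= h)%N.
  have [/existsP[i /andP[iR /eqP cix]]|/existsPn noi] :=
      boolP [exists i, (i \in R) && (c i == x)]; last first.
    rewrite /mult (_ : [set i in R' | c i == x] = set0) ?cards0 //.
    apply/setP=> i; rewrite !inE; apply/negbTE; have := noi i.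
    by apply: contra => /andP[/andP[_ ->] ->].
  have [j jA cji] := surjA i iR.
  rewrite -ltnS; apply: leq_trans (multR x); apply: proper_card; apply/properP.
  split; first by apply/subsetP=> k; rewrite !inE => /andP[/andP[_ ->] ->].
  exists j; first by apply/setIdP; rewrite (subsetP sAR) // cji cix.
  by apply/negP=> /setIdP[/setDP[_ /negP]].
have zR' W : W \subset R' -> (#|W| <= h)%N -> ssum W = 0 -> W = set0.
  by move=> sW leW; apply: zR; [apply: subset_trans sR'R|apply: leqW].
pose S := short_sums h R'; pose B := 0 |: [set c i | i in A].
have cn0 i : i \in R -> c i != 0.
  move=> iR; apply/eqP=> ci0; have /zR/(_ _ _)W0 : [set i] \subset R.
    by rewrite sub1set.
  by have := set11 i; rewrite W0 ?inE ?cards1 ?big_set1.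
have cardB : #|B| = #|A|.+1.
  rewrite cardsU1 card_in_imset //; case: imsetP => // -[i iA /esym/eqP].
  by rewrite (negPf (cn0 _ (subsetP sAR i iA))).
have S0 : 0 \in S.
  by apply/short_sumsP; exists set0; rewrite sub0set cards0 big_set0.
have addA U i : U \subset R' -> (#|U| <= h)%N -> i \in A ->
    [/\ i |: U \subset R, (#|i |: U| <= h.+1)%N & ssum (i |: U) = c i + ssum U].
  move=> sU leU iA; have iU : i \notin U.
    by apply/negP=> /(subsetP sU); rewrite inE iA.
  split; last exact: sum_set1U.
    by rewrite subUset sub1set (subsetP sAR) // (subset_trans sU).
  by rewrite cardsU1 iU.
have leSB : (#|S| + #|B| <= #|sumset S B| + 1)%N.
  apply: scherk => // [|x y /short_sumsP[U [sU leU ->]]]; first exact: setU11.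
  case/setU1P=> // /imsetP[i iA ->]; rewrite addrC => z0.
  have [sW leW sumW] := addA U i sU leU iA.
  by have := setU11 i U; rewrite (zR _ sW leW) ?inE // sumW.
have sSB : (#|sumset S B| <= #|short_sums h.+1 R|)%N.
  apply: subset_leq_card; apply/subsetP=> _ /imset2P[_ y /short_sumsP[U [sU leU ->]] + ->].
  case/setU1P=> [->|/imsetP[i iA ->]]; apply/short_sumsP.
    by exists U; rewrite addr0 leqW // (subset_trans sU).
  by have [sW leW sumW] := addA U i sU leU iA; exists (i |: U); rewrite addrC.
have := IH R' multR' zR'; have := cardsID A R; rewrite (setIidPr sAR) -/R' -/S.
lia.
Qed.

(** Otherwise there would be more than [#|R|] short sums, all of them in [K]. *)
Lemma exists_short_zero_sum h K R : (forall i, i \in R -> c i \in K) ->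
  (forall x, mult R x <= h)%N -> (#|K| <= #|R|)%N ->
  exists W, [/\ W \subset R, (0 < #|W| <= h)%N & ssum W = 0].
Proof.
move=> cK multR leKR.
have [/existsP[W /and4P[sW gW lW /eqP W0]]|/existsPn noW] := boolP [exists W : {set I},
    [&& W \subset R, (0 < #|W|)%N, (#|W| <= h)%N & ssum W == 0]].
  by exists W; rewrite gW.
suff le1 : (#|short_sums h R| <= #|K|)%N.
  have := @card_short_sums h R multR.
  suff zR W : W \subset R -> (#|W| <= h)%N -> ssum W = 0 -> W = set0.
    by move=> /(_ zR); lia.
  move=> sW leW W0; apply/eqP; rewrite -cards_eq0 -leqn0 leqNgt.
  by apply: contra (noW W) => gW; rewrite sW gW leW W0 eqxx.
apply: subset_leq_card; apply: subset_trans (sums_group cK).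
apply/subsetP=> _ /short_sumsP[U [sU _ ->]]; by apply/sumsP; exists U.
Qed.

End ShortSums.

(** * Prescribed sums over sets of prescribed size *)

Section FixedSize.

Local Open Scope ring_scope.

Variables (V : finZmodType) (I : finType) (c : I -> V).
Implicit Types (T U W R : {set I}) (J K : {group V}) (x y : V).

Local Notation ssum U := (\sum_(i in (U : {set I})) c i).

(* Enlarge the representing set by short zero-sum sets of nonzero terms as long
   as the zeros of [T] cannot fill it up to size [t]. *)
Lemma extend_to_size t K T U0 : (forall i, i \in T -> c i \in K) ->
  (forall x, mult c T x <= mult c T 0%R)%N -> (t + #|K| <= #|T| + 1)%N ->
  U0 \subset T -> (#|U0| <= t)%N ->
  exists U, [/\ U \subset T, #|U| = t & ssum U = ssum U0].
Proof.
move=> cK mult0 leT sU0 leU0; set h := mult c T 0.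
pose Z := [set i in T | c i == 0].
have sZT : Z \subset T by apply/subsetP=> i /setIdP[].
have sumZ U : U \subset Z -> ssum U = 0.
  by move=> /subsetP sU; apply: big1 => i /sU/setIdP[_ /eqP].
pose P U := [&& U \subset T :\: Z, (#|U| <= t)%N & ssum U == ssum U0].
have PU1 : P (U0 :\: Z).
  rewrite /P setSD // (leq_trans _ leU0) ?subset_leq_card ?subsetDl //=.
  rewrite [eqbRHS](big_setID Z) /=; have := sumZ (U0 :&: Z) (subsetIr _ _).
  by move=> ->; rewrite add0r.
case: (@arg_maxnP _ (U0 :\: Z) P (fun U => #|U|) PU1) => U /and3P[sU leU /eqP sumU] maxU.
have sUT : U \subset T := subset_trans sU (subsetDl _ _).
have disZ W : W \subset Z -> [disjoint U & W].
  move=> sW; rewrite -setI_eq0; apply/eqP/setP=> i; rewrite in_setI in_set0.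
  apply/negP=> /andP[/(subsetP sU)/setDP[_ /negP iZ] /(subsetP sW)]; exact: iZ.
have [le_t|gt_t] := leqP t (#|U| + h).
  have [W sW cW] : exists2 W : {set I}, W \subset Z & #|W| = (t - #|U|)%N.
    by apply: exists_subset_card; rewrite -/(mult c T 0) -/h; lia.
  exists (U :|: W); split.
  - by rewrite subUset sUT (subset_trans sW).
  - by rewrite cardsU (disjoint_setI0 (disZ W sW)) cards0; lia.
  - by rewrite ssumU ?disZ // (sumZ W) // addr0.
(* Here [#|U| + h < t], so at least [#|K|] elements remain in [R]. A zero-sum set of size at most
   [h] among them contradicts the maximality of [U]. *)
pose R := (T :\: Z) :\: U.
have cardR : (#|R| + #|U| + h)%N = #|T|.
  have := cardsID Z T; rewrite (setIidPr sZT) -/(mult c T 0) -/h.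
  by have := cardsID U (T :\: Z); rewrite (setIidPr sU) -/R; lia.
have sRT : R \subset T by rewrite /R setDDl subsetDl.
have [||| W [sW /andP[gW lW] W0]] := @exists_short_zero_sum V I c h K R.
- by move=> i iR; apply/cK/(subsetP sRT).
- move=> x; apply: leq_trans (mult0 x); apply: subset_leq_card.
  by apply/subsetP=> i /setIdP[iR cix]; rewrite inE cix (subsetP sRT).
- lia.
have disW : [disjoint U & W].
  rewrite -setI_eq0; apply/eqP/setP=> i; rewrite in_setI in_set0.
  by apply/negP=> /andP[iU /(subsetP sW)/setDP[_ /negP]].
have cardUW : #|U :|: W| = (#|U| + #|W|)%N.
  by rewrite cardsU (disjoint_setI0 disW) cards0 subn0.
have /maxU : P (U :|: W).
  rewrite /P subUset sU (subset_trans sW) ?subsetDl //= cardUW ssumU //.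
  by rewrite W0 addr0 sumU eqxx andbT; lia.
by rewrite cardUW; lia.
Qed.

(** A zero-sum part of a representation can be deleted, so a smallest one is zero-sum free. *)
Lemma minimal_representation T x : x \in sums c T ->
  exists U, [/\ U \subset T, ssum U = x, zero_free c U &
    forall W, W \subset T -> ssum W = x -> (#|U| <= #|W|)%N].
Proof.
case/sumsP=> U0 sU0 xE.
pose P (U : {set I}) := (U \subset T) && (ssum U == x).
have PU0 : P U0 by rewrite /P sU0 xE eqxx.
case: (@arg_minnP _ U0 P (fun U => #|U|) PU0) => U /andP[sU /eqP sumU] minU.
exists U; split=> // [W sW W0|W sW sumW]; last by apply: minU; rewrite /P sW sumW eqxx.
have /minU : P (U :\: W).
  by rewrite /P (subset_trans (subsetDl _ _) sU) ssumD // W0 subr0 sumU eqxx.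
rewrite cardsD (setIidPr sW) => leW; apply/eqP; rewrite -cards_eq0.
have := subset_leq_card sW; lia.
Qed.

Lemma zero_free_lt_card K U : (forall i, i \in U -> c i \in K) ->
  zero_free c U -> (#|U| < #|K|)%N.
Proof.
move=> cK zU; apply: leq_trans (zero_free_card zU) _.
exact: subset_leq_card (sums_group cK).
Qed.

Lemma fixed_size_sum t K T x : (forall i, i \in T -> c i \in K) ->
  K \subset sums c T -> (forall y, mult c T y <= mult c T 0%R)%N ->
  (t + #|K| <= #|T| + 1)%N -> (#|K| <= t + 1)%N -> x \in K ->
  exists U, [/\ U \subset T, #|U| = t & ssum U = x].
Proof.
move=> cK full mult0 leT leK xK.
have [U [sU <- zU _]] := minimal_representation (subsetP full x xK).
apply: extend_to_size leT _ _ => //.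
have : (#|U| < #|K|)%N by apply: zero_free_lt_card zU => i /(subsetP sU)/cK.
lia.
Qed.

(** A minimal representation may now have [t + 1] elements, one too many. It then has a single value
    [v], as two values would give too many sums; so [x = - v], and the multiples of [v] fill [V]. A
    term of [T] equal to a sum of two or more copies of [v] could replace them, against
    minimality. *)
Lemma fixed_size_sum_exceptional t T x : [set: V] \subset sums c T ->
  (forall y, mult c T y <= mult c T 0%R)%N ->
  (t + #|V| <= #|T| + 1)%N -> (#|V| = t + 2)%N ->
  (exists U, [/\ U \subset T, #|U| = t & ssum U = x]) \/
  (forall i, i \in T -> c i = 0 \/ c i = - x).
Proof.
move=> /subsetP full mult0 leT cV; have fullT y : y \in sums c T by apply: full.
have [U [sU sumU zU minU]] := minimal_representation (fullT x).
have cVT : #|[set: V]%G| = #|V| by rewrite cardsT.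
have [leU|gtU] := leqP #|U| t.
  left; rewrite -sumU; apply: (@extend_to_size t [set: V]%G) => //.
    by move=> i _; apply: in_setT.
  by rewrite cVT.
have leU : (#|U| < #|V|)%N.
  by rewrite -cVT; apply: zero_free_lt_card zU => i _; apply: in_setT.
have cU : #|U| = (t + 1)%N by lia.
have cstU : {in U &, forall i j, c i = c j}.
  move=> i j iU jU; apply/eqP/negPn/negP=> nij.
  have := leq_trans (zero_free_card2 iU jU nij zU) (max_card _).
  by rewrite cU cV; lia.
have [i iU] : exists i, i \in U by apply/card_gt0P; rewrite cU; lia.
have sumW W : W \subset U -> ssum W = c i *+ #|W|.
  by move=> /subsetP sW; rewrite -sumr_const; apply: eq_bigr => j /sW jU; apply: cstU.
have xE : x = - c i.
  apply/eqP; rewrite -sumU sumW // -addr_eq0 -mulrSr cU.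
  by rewrite -(addnS t 1) -cV mulrn_card.
have fullU : sums c U = [set: V].
  apply/eqP; rewrite eqEcard subsetT cardsT cV.
  by have := zero_free_card zU; rewrite cU; lia.
right=> j jT; have := in_setT (c j); rewrite -fullU => /sumsP[W sW cjE].
have [W1|gtW] := leqP #|W| 1.
  move: W1; rewrite leq_eqVlt ltnS leqn0 => /orP[/eqP W1|/eqP W0].
    by right; rewrite cjE sumW // W1 xE opprK.
  by left; rewrite cjE sumW // W0.
have [jU|jU] := boolP (j \in U).
  by right; rewrite (cstU j i) // xE opprK.
have /minU : j |: (U :\: W) \subset T.
  by rewrite subUset sub1set jT (subset_trans (subsetDl _ _) sU).
rewrite sum_set1U ?inE ?(negPf jU) ?andbF // cjE ssumD // addrC subrK.
move=> /(_ sumU); rewrite cardsU1 !inE (negPf jU) andbF cardsD (setIidPr sW).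
have := subset_leq_card sW; lia.
Qed.

End FixedSize.

(** * Translating the colours; the Erdos-Ginzburg-Ziv theorem *)

Section Shift.

Local Open Scope ring_scope.

Variables (V : finZmodType) (I : finType) (c : I -> V).
Implicit Types (T U : {set I}) (z x : V).

Lemma sum_shift U z :
  \sum_(i in U) (c i - z) = \sum_(i in U) c i - z *+ #|U|.
Proof. by rewrite sumrB sumr_const. Qed.

Lemma mult_shift T z x : mult (fun i => c i - z) T x = mult c T (x + z).
Proof. by apply: eq_card => i; rewrite !inE subr_eq. Qed.

Lemma most_frequent T : exists z, forall x, (mult c T x <= mult c T z)%N.
Proof.
case: (@arg_maxnP _ (0 : V) xpredT (mult c T) erefl) => z _ maxz.
by exists z => x; apply: maxz.
Qed.

(** Translate the most frequent value to [0] and extend the empty set to size [t]; as [#|V|] divides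
    [t], the translation does not affect the sum. *)
Lemma erdos_ginzburg_ziv t T : (#|V| %| t)%N -> (t + #|V| <= #|T| + 1)%N ->
  exists U : {set I}, [/\ U \subset T, #|U| = t & \sum_(i in U) c i = 0].
Proof.
move=> /dvdnP[q tE] leT; have [z maxz] := most_frequent T.
have [|x||||U [sU cU]] := @extend_to_size V I (fun i => c i - z) t [set: V]%G T set0.
- by move=> i _; apply: in_setT.
- by rewrite !mult_shift add0r.
- by rewrite cardsT.
- exact: sub0set.
- by rewrite cards0.
rewrite sum_shift big_set0 => U0; exists U; split=> //; move: U0.
by rewrite cU tE mulnC mulrnA mulrn_card mul0rn subr0.
Qed.

End Shift.

(** * Zero-sum sets containing two indices at distance at least [D] *)

Lemma far_pair N D (Z : {set 'I_N}) : (D < #|Z|)%N ->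
  exists i j, [/\ i \in Z, j \in Z & (i + D <= j)%N].
Proof.
move=> ltD; have /card_gt0P[k kZ] : (0 < #|Z|)%N by lia.
case: (@arg_minnP _ k (mem Z) (@nat_of_ord N) kZ) => i iZ mini.
case: (@arg_maxnP _ k (mem Z) (@nat_of_ord N) kZ) => j jZ maxj.
exists i, j; split=> //.
have ij := mini j jZ; suff : (#|Z| <= (j - i).+1)%N by lia.
rewrite cardE -(size_map val) -(size_iota i (j - i).+1).
apply: uniq_leq_size; first by rewrite map_inj_uniq ?enum_uniq //; apply: val_inj.
move=> _ /mapP[x + ->]; rewrite mem_enum => xZ; rewrite mem_iota.
by have /= := mini x xZ; have /= := maxj x xZ; lia.
Qed.

Section FarZeroSum.

Local Open Scope ring_scope.

Variables (V : finZmodType) (D l : nat) (c : 'I_(D + l) -> V).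
Hypotheses (V3 : (3 <= #|V|)%N) (VD : (#|V| <= D)%N) (Vl : (#|V| < l)%N).
Hypothesis no_far : forall M : {set 'I_(D + l)}, #|M| = #|V| ->
  \sum_(i in M) c i = 0 -> forall i j, i \in M -> j \in M -> ~ (i + D <= j)%N.

Implicit Types (i j : 'I_(D + l)) (T U : {set 'I_(D + l)}) (J K : {group V}) (x y z : V).

Let far_pair_no_completion i j U : (i + D <= j)%N -> U \subset ~: [set i; j] ->
  #|U| = (#|V| - 2)%N -> \sum_(k in U) c k <> - (c i + c j).
Proof.
move=> ij sU cU sumU; have nij : i != j by apply/eqP=> E; move: ij; rewrite E; lia.
have [iU jU] : i \notin U /\ j \notin U.
  by split; apply/negP=> /(subsetP sU); rewrite !inE eqxx ?orbT.
have jiU : i \notin j |: U by rewrite !inE negb_or nij.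
apply: (@no_far (i |: (j |: U)) _ _ i j _ _ ij); rewrite ?inE ?eqxx ?orbT //.
  by rewrite !cardsU1 jiU jU cU; lia.
by rewrite !sum_set1U // sumU addrA subrr.
Qed.

Definition misses z K := #|[set i | c i - z \notin K]|.

(** Otherwise more than [D] indices have colour [z], hence two far apart; with [#|V| - 2] further
    ones they form a forbidden zero-sum set. *)
Let misses1 z : (#|V| < misses z 1%G)%N.
Proof.
rewrite ltnNge; apply/negP=> le1; pose Z := [set i | c i == z].
have ZE : [set i | c i - z \notin 1%G] = ~: Z.
  by apply/setP=> i; rewrite !inE subr_eq0.
have cZ : (#|Z| + misses z 1%G)%N = (D + l)%N.
  by rewrite /misses ZE cardsC card_ord.
have ltl := leq_ltn_trans le1 Vl.
have ltZ : (D < #|Z|)%N by rewrite -(ltn_add2r (misses z 1%G)) cZ ltn_add2l.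
have [i [j [iZ jZ ij]]] := far_pair ltZ.
have nij : i != j by apply/eqP=> E; move: ij; rewrite E; lia.
have [|U sU cU] := @exists_subset_card _ (Z :\: [set i; j]) (#|V| - 2)%N.
  rewrite cardsD (setIidPr _) ?cards2 ?nij; first by lia.
  by rewrite subUset !sub1set iZ jZ.
apply: (far_pair_no_completion ij _ cU).
  by apply: subset_trans sU _; rewrite setDE subsetIr.
have -> : \sum_(k in U) c k = z *+ (#|V| - 2).
  rewrite -cU -sumr_const; apply: eq_bigr => k /(subsetP sU).
  by rewrite !inE => /andP[_ /eqP].
move: iZ jZ; rewrite !inE => /eqP-> /eqP->.
apply/eqP; rewrite -addr_eq0 -mulr2n -mulrnDr subnK ?mulrn_card //; lia.
Qed.

Let few_missed : exists z0 K, [/\ (misses z0 K * #|K| <= #|V|)%N &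
  forall J z, J \proper K -> (#|V| < misses z J * #|J|)%N].
Proof.
pose P (K : {group V}) := [exists z, misses z K * #|K| <= #|V|]%N.
have PV : P [set: V]%G.
  apply/existsP; exists 0; rewrite (_ : misses _ _ = 0%N) //.
  by apply/eqP; rewrite cards_eq0; apply/eqP/setP=> i; rewrite !inE.
case: (@arg_minnP _ [set: V]%G P (fun K : {group V} => #|K|) PV) => K /existsP[z0 PK] minK.
exists z0, K; split=> // J z pJK; rewrite ltnNge; apply/negP=> leJ.
have /minK : P J by apply/existsP; exists z.
by rewrite leqNgt proper_card.
Qed.

(** Of the many indices outside [z + J], only those outside [z0 + K] and the pair [i], [j] are lost
    in [T]; enough remain for [sums_full]. *)
Let coset_sums_full z0 K i j z : (misses z0 K * #|K| <= #|V|)%N ->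
  (forall J y, J \proper K -> (#|V| < misses y J * #|J|)%N) -> z - z0 \in K ->
  K \subset sums (fun k => c k - z) ([set k | c k - z0 \in K] :\: [set i; j]).
Proof.
move=> few many zK; set T := _ :\: _.
apply: sums_full => [k|J pJK].
  rewrite !inE => /andP[_ kK].
  by rewrite -(subrKA z0) -(opprB z z0); apply: groupDr => //; apply: groupNr.
set S := [set k in T | _].
have leS : (misses z J <= #|S| + misses z0 K + 2)%N.
  pose S' := S :|: [set k | c k - z0 \notin K].
  have sS : [set k | c k - z \notin J] \subset S' :|: [set i; j].
    apply/subsetP=> k; rewrite !inE => ->.
    by case: (c k - z0 \in K); case: (k == i); case: (k == j).
  apply: leq_trans (subset_leq_card sS) _.
  apply: leq_trans (leq_card_setU _ _) _; apply: leq_add.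
    exact: leq_card_setU.
  by rewrite cards2; case: (i != j).
have := many J z pJK; have ltJ := proper_card pJK.
have /dvdnP[b Kb] := cardSg (proper_sub pJK).
have /dvdnP[d Vd] : (#|K| %| #|V|)%N by rewrite -[#|V|]cardsT cardSg ?subsetT.
have gJ := cardG_gt0 J.
have e0 : d = 1%N -> misses z0 K = 0%N.
  move=> d1; have KV : K = [set: V]%G.
    by apply/val_inj/eqP; rewrite eqEcard subsetT /= cardsT Vd d1 mul1n leqnn.
  by apply/eqP; rewrite cards_eq0 KV; apply/eqP/setP=> k; rewrite !inE.
have gd : (0 < d)%N.
  by have : (0 < #|V|)%N := leq_trans (isT : (0 < 3)%N) V3; rewrite Vd muln_gt0 => /andP[].
move: few leS e0 ltJ gJ; rewrite Vd Kb.
move: (misses z J) (misses z0 K) #|S| #|J| => e' e n x few leS e0 ltJ gJ.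
rewrite mulnA !ltn_pmul2r // => lte'; rewrite leq_pmul2r //.
have b2 : (1 < b)%N by rewrite -(ltn_pmul2r gJ) mul1n.
have ed : (e <= d)%N.
  by rewrite -(leq_pmul2r (_ : 0 < b * x)%N) // muln_gt0 gJ ltnW.
(* With indices [b] of [J] in [K] and [d] of [K] in [V], the facts are [e <= d] and
   [d * b < e' <= n + e + 2]. If [d = 1], then [e = 0]; otherwise [d * b - d >= b]. Both cases give
   [b <= n + 1]. *)
case: d {Vd} gd few e0 lte' ed => [//|[|d]] _ few e0 lte' ed.
- by have := e0 erefl; lia.
- nia.
Qed.

(** If [K] is proper, its coset contains a far pair that can be completed, a contradiction. If [K]
    is the whole group, only the exceptional alternative for the given pair survives. *)
Let exceptional_pair i j : (i + D <= j)%N -> exists z a,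
  c i + c j = z + a /\ forall k, k \notin [set i; j] -> c k = z \/ c k = a.
Proof.
move=> ij; have [z0 [K [few many]]] := few_missed.
pose Q := [set k | c k - z0 \in K]; pose e := misses z0 K.
have cQ : (#|Q| + e)%N = (D + l)%N.
  rewrite /e (_ : misses z0 K = #|~: Q|) ?cardsC ?card_ord //.
  by apply: eq_card => k; rewrite !inE.
have gK := cardG_gt0 K.
have leKV : (#|K| <= #|V|)%N by rewrite -[#|V|]cardsT subset_leq_card ?subsetT.
have boundT : (#|V| - 2 + #|K| + e <= 2 * #|V|)%N.
  move: few leKV gK V3; rewrite -/e; move: #|K| #|V| => x v; clear; case: (e) => [|f]; nia.
have ltQ : (D < #|Q|)%N.
  rewrite -(ltn_add2r e) cQ ltn_add2l (leq_trans _ Vl) // ltnS.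
  by apply: leq_trans few; rewrite leq_pmulr.
have pairs i1 j1 : (i1 + D <= j1)%N -> i1 \in Q -> j1 \in Q ->
  let T := Q :\: [set i1; j1] in
  exists z, [/\ z - z0 \in K, forall x, (mult (fun k => c k - z)%R T x <=
    mult (fun k => c k - z)%R T 0%R)%N, (#|V| - 2 + #|K| <= #|T| + 1)%N,
    z - c i1 + (z - c j1) \in K &
    forall U, U \subset T -> #|U| = (#|V| - 2)%N ->
      \sum_(k in U) (c k - z) <> z - c i1 + (z - c j1)].
  move=> ij1 iQ jQ T.
  have nij : i1 != j1 by apply/eqP=> E; move: ij1; rewrite E; lia.
  have cT : (#|T| + 2)%N = #|Q|.
    rewrite -(cardsID [set i1; j1] Q) (setIidPr _) ?cards2 ?nij 1?addnC //.
    by rewrite subUset !sub1set iQ jQ.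
  have [z maxz] := most_frequent c T; exists z.
  have zK : z - z0 \in K.
    have /card_gt0P[k kT] : (0 < #|T|)%N by lia.
    have /card_gt0P[k'] : (0 < mult c T z)%N.
      by apply: leq_trans (maxz (c k)); apply/card_gt0P; exists k; rewrite inE kT eqxx.
    by rewrite !inE => /andP[/andP[_ kQ] /eqP <-].
  have zcK k : k \in Q -> z - c k \in K.
    rewrite inE => kK; rewrite -(subrKA z0) -(opprB (c k) z0).
    by apply: groupDr => //; apply: groupNr.
  split=> // [x|||U sU cU sumU].
  - by rewrite !mult_shift add0r.
  - lia.
  - by apply: groupDr; apply: zcK.
  apply: (far_pair_no_completion ij1 _ cU).
    by apply: subset_trans sU _; rewrite /T setDE subsetIr.
  (* The [#|V| - 2] shifted terms and the two of the pair together contribute [z *+ #|V| = 0]. *)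
  apply/eqP; move/eqP: sumU; rewrite sum_shift subr_eq cU => /eqP->.
  by rewrite addrACA -opprD -mulr2n addrAC -mulrnDr subnKC ?mulrn_card ?add0r //; lia.
have [ltKV|geKV] := ltnP #|K| #|V|.
  have [i1 [j1 [iQ jQ ij1]]] := far_pair ltQ.
  have [z [zK maxz cT xK noU]] := pairs i1 j1 ij1 iQ jQ.
  have full := coset_sums_full i1 j1 few many zK.
  have [k /setDP[kQ _]||U [sU cU sumU]] := fixed_size_sum _ full maxz cT _ xK.
  - rewrite inE in kQ; rewrite -(subrKA z0) -(opprB z z0).
    by apply: groupDr => //; apply: groupNr.
  - by move: ltKV V3; move: #|V| #|K|; lia.
  by case: (noU U sU cU sumU).
have KV : K = [set: V]%G.
  by apply/val_inj/eqP; rewrite eqEcard subsetT /= cardsT.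
have inQ k : k \in Q by rewrite inE KV inE.
have [z [zK maxz cT xK noU]] := pairs i j ij (inQ i) (inQ j).
have full := coset_sums_full i j few many zK.
have TE k : k \notin [set i; j] -> k \in Q :\: [set i; j].
  by rewrite in_setD (inQ k) andbT.
have [|||[U [sU cU sumU]]|colors] :=
    @fixed_size_sum_exceptional _ _ _ (#|V| - 2) _ (z - c i + (z - c j)) _ maxz.
- by rewrite {1}KV in full.
- by rewrite KV cardsT in cT.
- by rewrite subnK // ltnW.
- by case: (noU U sU cU sumU).
exists z, (c i + c j - z); split=> [|k /TE/colors[]]; first by rewrite addrCA subrr addr0.
  by move/eqP; rewrite subr_eq0 => /eqP->; left.
move/eqP; rewrite subr_eq => /eqP->; right.
by rewrite addrACA -opprD -mulr2n opprB mulr2n opprD addrA subrK.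
Qed.

Lemma end_segments_constant :
  (forall i j : 'I_(D + l), (i < l)%N -> (j < l)%N -> c i = c j) /\
  (forall i j : 'I_(D + l), (D <= i)%N -> (D <= j)%N -> c i = c j).
Proof.
(* By [misses1] two different colours occur outside the at most three indices of [A :|: B]; each of
   the two colour pairs must consist of exactly these. *)
have same_sum (A B : {set 'I_(D + l)}) z a z' a' : (#|A :|: B| <= 3)%N ->
    (forall k, k \notin A -> c k = z \/ c k = a) ->
    (forall k, k \notin B -> c k = z' \/ c k = a') -> z + a = z' + a'.
  move=> le3 cA cB.
  have outside y : exists2 k, k \notin A :|: B & c k != y.
    have : ~~ ([set k | c k - y \notin 1%G] \subset A :|: B).
      apply/negP=> /subset_leq_card; have := misses1 y; rewrite /misses.
      by move=> h1 h2; have := leq_trans h1 (leq_trans h2 (leq_trans le3 V3)); rewrite ltnn.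
    by case/subsetPn=> k; rewrite !inE subr_eq0 => cky kAB; exists k; rewrite ?inE.
  have [k0 k0P _] := outside 0; have [k1 k1P c10] := outside (c k0).
  move: k0P k1P; rewrite !inE !negb_or => /andP[A0 B0] /andP[A1 B1].
  have two x y : c k0 = x \/ c k0 = y -> c k1 = x \/ c k1 = y ->
      x + y = c k0 + c k1.
    move: c10 => /eqP c10 [E0|E0] [E1|E1]; rewrite E0 E1 in c10 * => //.
    exact: addrC.
  by rewrite (two _ _ (cA _ A0) (cA _ A1)) (two _ _ (cB _ B0) (cB _ B1)).
have cardU3 (x y w : 'I_(D + l)) : (#|[set x; y] :|: [set x; w]| <= 3)%N.
  have -> : [set x; y] :|: [set x; w] = [set x; y; w].
    by apply/setP=> k; rewrite !inE; case: (k == x).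
  by rewrite (leq_trans (leq_card_setU _ _)) // cards2 cards1; case: (x != y).
have gl : (0 < l)%N by apply: leq_ltn_trans Vl.
have ltDl : ((D + l).-1 < D + l)%N by lia.
(* [fst] is far from each of the last [l] indices, and [lst] from each of the first [l]. *)
pose fst : 'I_(D + l) := Ordinal (leq_trans gl (leq_addl D l)).
pose lst : 'I_(D + l) := Ordinal ltDl.
split=> i j hi hj.
  have [|z [a [E C]]] := @exceptional_pair i lst; first by rewrite /=; lia.
  have [|z' [a' [E' C']]] := @exceptional_pair j lst; first by rewrite /=; lia.
  apply: (addIr (c lst)); rewrite E E'; apply: same_sum C C'.
  by rewrite ![[set _; lst]]setUC.
have [//|z [a [E C]]] := @exceptional_pair fst i.
have [//|z' [a' [E' C']]] := @exceptional_pair fst j.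
by apply: (addrI (c fst)); rewrite E E'; apply: same_sum C C'.
Qed.

End FarZeroSum.

(** * Extrema of finite sets, windows of integers, and residues *)

Lemma mem_interval a b x : (x \in Defs.interval a b) = (a <= x <= b).
Proof. by rewrite /Defs.interval in_fset /= mem_iota; lia. Qed.

Section Extrema.

Implicit Types (X : {fset nat}) (x a b : nat).

Lemma leq_fmax X x : x \in X -> (x <= fmax X)%N.
Proof. by move=> xX; rewrite /fmax; apply: leq_bigmax_seq. Qed.

Lemma fmax_leq X b : (forall x, x \in X -> x <= b)%N -> (fmax X <= b)%N.
Proof. by move=> leb; rewrite /fmax; apply/bigmax_leqP_seq => x xX _; apply: leb. Qed.

Lemma fmin_leq X x : x \in X -> (fmin X <= x)%N.
Proof.
rewrite /fmin -[x \in X]/(x \in enum_fset X).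
elim: (enum_fset X) (fmax X) => // y s IH b.
rewrite inE big_cons geq_min => /orP[/eqP->|/IH->]; first by rewrite leqnn.
by rewrite orbT.
Qed.

Lemma leq_fmin X a : X != fset0%fset -> (forall x, x \in X -> a <= x)%N -> (a <= fmin X)%N.
Proof.
case/fset0Pn=> y yX lea; rewrite /fmin big_seq.
apply: (big_ind (fun m => a <= m)%N) => [|m n am an|x /lea//].
  (* The starting value [fmax X] is at least [a] because [X] has an element. *)
  exact: leq_trans (lea _ yX) (leq_fmax yX).
by rewrite leq_min am.
Qed.

Lemma card_le_span X : (#|` X| <= (fmax X).+1 - fmin X)%N.
Proof.
rewrite -[leqRHS](size_iota (fmin X)); apply: uniq_leq_size => [|x xX].
  exact: fset_uniq.
by rewrite mem_iota; have := leq_fmax xX; have := fmin_leq xX; lia.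
Qed.

End Extrema.

Definition shift_set N p (M : {set 'I_N}) : {fset nat} := [fset (p + val i)%N | i in M]%fset.

Section ShiftSet.

Local Open Scope ring_scope.

Variables (N p : nat) (M : {set 'I_N}).

Lemma shift_setP x : reflect (exists2 i, i \in M & x = (p + i)%N) (x \in shift_set p M).
Proof. exact: imfsetP. Qed.

Lemma card_shift_set : #|` shift_set p M| = #|M|.
Proof. by rewrite card_imfset /= ?cardE // => i j /addnI/val_inj. Qed.

Lemma sum_shift_set (W : nmodType) (F : nat -> W) :
  \sum_(x <- shift_set p M) F x = \sum_(i in M) F (p + i)%N.
Proof. by rewrite big_imfset /= ?big_enum // => i j _ _ /addnI/val_inj. Qed.

End ShiftSet.

Section Residues.

Local Open Scope ring_scope.

Lemma Zp_intr_eq0 m (x : int) : (1 < m)%N -> x%:~R = 0 :> 'Z_m -> (m%:Z %| x)%Z.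
Proof.
move=> m1; have nat0 n : n%:R = 0 :> 'Z_m -> (m%:Z %| n%:Z)%Z.
  move/(congr1 (@nat_of_ord _)); rewrite val_Zp_nat //= => n0.
  by apply/eqP; rewrite -n0.
case: x => n; first exact: nat0.
by rewrite NegzE mulrNz rpredN => /eqP; rewrite oppr_eq0 => /eqP/nat0.
Qed.

Lemma zero_sumE m Delta X : zero_sum m Delta X <-> (m%:Z %| \sum_(x <- X) Delta x)%Z.
Proof. by rewrite /zero_sum mod0z; split=> [/dvdz_mod0P//|/dvdz_mod0P]. Qed.

End Residues.

Lemma separated_pair n a b x y (S1 S2 : {fset nat}) :
  S1 != fset0 -> 0 < a -> (forall u, u \in S1 -> a <= u <= b) ->
  (forall u, u \in S2 -> b < u <= n) -> x \in S2 -> y \in S2 -> b - a <= y - x ->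
  [/\ (S1 `<=` Defs.interval 1 n /\ S2 `<=` Defs.interval 1 n)%fset,
      fmax S1 < fmin S2 & diam S1 <= diam S2].
Proof.
move=> nS1 a0 S1P S2P xS yS le_xy.
have nS2 : S2 != fset0 by apply/fset0Pn; exists x.
have [u uS1] := fset0Pn _ nS1.
have max1 : fmax S1 <= b by apply: fmax_leq => v /S1P/andP[].
have min1 : a <= fmin S1 by apply: leq_fmin => // v /S1P/andP[].
have min2 : b < fmin S2 by apply: leq_fmin => // v /S2P/andP[].
split.
- split; apply/fsubsetP=> v vS; rewrite mem_interval.
    by have := S1P v vS; have := S2P x xS; lia.
  by have := S2P v vS; lia.
- exact: leq_ltn_trans max1 min2.
- rewrite /diam; have := leq_fmax yS; have := fmin_leq xS; lia.
Qed.

(** * The upper bound *)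

Section Upper.

Local Open Scope ring_scope.

Lemma card_Zp_type m : (1 < m)%N -> #|('Z_m : finZmodType)| = m.
Proof. by move=> m1; rewrite card_ord Zp_cast. Qed.

Lemma egz_window m t N (F : nat -> int) : (1 < m)%N -> (m %| t)%N ->
  (t + m <= N + 1)%N -> exists2 M : {set 'I_N}, #|M| = t &
    (m%:Z %| \sum_(i in M) F i)%Z.
Proof.
move=> m1 mt leN.
have [||M [_ cM sM]] :=
    @erdos_ginzburg_ziv 'Z_m 'I_N (fun i => (F i)%:~R) t [set: 'I_N].
- by rewrite card_Zp_type.
- by rewrite card_Zp_type // cardsT card_ord.
exists M => //; apply: Zp_intr_eq0 => //.
by rewrite rmorph_sum.
Qed.

Lemma upper_bound r s k : (3 <= s)%N -> (s <= r)%N -> (r <= 2 * s - 2)%N ->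
  (1 < k)%N -> (k < s)%N -> (r < s + k - 1)%N -> s = (k * gcdn r s)%N ->
  good s r (5 * s + k - 4).
Proof.
move=> hs hsr hr k1 ks hl sE Delta.
have r1 : (1 < r)%N by lia.
(* The window of [D + l] integers from [p] ends at [5s + k - 4]. The length [l] is what
   Erdos-Ginzburg-Ziv modulo [k] needs to produce [s] elements. *)
pose D := (2 * s - 2)%N; pose l := (s + k - 1)%N; pose p := (2 * s)%N.
have far_S2 (M : {set 'I_(D + l)}) : #|M| = r ->
  \sum_(i in M) (Delta (p + i)%N)%:~R = 0 :> 'Z_r ->
  [/\ zero_sum r Delta (shift_set p M), #|` shift_set p M| = r &
     forall u, u \in shift_set p M -> (p <= u <= 5 * s + k - 4)%N].
  move=> cM sM; split; last 2 first.
  - by rewrite card_shift_set.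
  - by move=> _ /shift_setP[i iM ->]; have := ltn_ord i; rewrite /p /D /l; lia.
  apply/zero_sumE; rewrite sum_shift_set; apply: Zp_intr_eq0 => //.
  by rewrite rmorph_sum.
have nonempty (S : {fset nat}) : #|` S| = s -> S != fset0%fset.
  by move=> cS; rewrite -cardfs_gt0 cS; lia.
have [/existsP[M /and3P[/eqP cM /eqP sM far]]|/existsPn noM] :=
  boolP [exists M : {set 'I_(D + l)}, [&& #|M| == r,
    \sum_(i in M) (Delta (p + i)%N)%:~R == 0 :> 'Z_r &
    [exists i, exists j, [&& i \in M, j \in M & (i + D <= j)%N]]]].
  have [i /existsP[j /and3P[iM jM ij]]] := existsP far.
  have [|||M1 cM1 sM1] := @egz_window s s (2 * s - 1) (fun i => Delta (1 + i)%N).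
  - lia.
  - by [].
  - lia.
  have [z2 c2 b2] := far_S2 M cM sM; exists (shift_set 1 M1), (shift_set p M).
  have c1 : #|` shift_set 1 M1| = s by rewrite card_shift_set.
  have [|||||||sub lt12 diam12] := @separated_pair (5 * s + k - 4) 1 (2 * s - 1)
    (p + i) (p + j) (shift_set 1 M1) (shift_set p M).
  - exact: nonempty.
  - by [].
  - by move=> _ /shift_setP[x _ ->]; have := ltn_ord x; lia.
  - by move=> u /b2; rewrite /p; lia.
  - by apply/shift_setP; exists i.
  - by apply/shift_setP; exists j.
  - by move: ij; rewrite /D; lia.
  split=> //; split=> //.
  by apply/zero_sumE; rewrite sum_shift_set.
pose c (i : 'I_(D + l)) : 'Z_r := (Delta (p + i)%N)%:~R.
have cV := card_Zp_type r1.
have [||||firstc lastc] := @end_segments_constant 'Z_r D l c.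
- by rewrite cV; lia.
- by rewrite cV /D; lia.
- by rewrite cV /l; lia.
- move=> M cM sM i j iM jM ij; case/negP: (noM M); apply/and3P; split.
  + by rewrite cM cV.
  + exact/eqP.
  + by apply/existsP; exists i; apply/existsP; exists j; apply/and3P.
have l0 : (0 < l)%N by rewrite /l; lia.
have sub_r (i j : 'I_(D + l)) : c i = c j ->
    (r%:Z %| Delta (p + i)%N - Delta (p + j)%N)%Z.
  by move=> cij; apply: Zp_intr_eq0 => //; rewrite rmorphB /= -/(c i) -/(c j) cij subrr.
pose g := gcdn r s.
have g_dvd i : (i < l)%N -> (g%:Z %| Delta (p + i)%N - Delta p)%Z.
  move=> il; have lt0 : (0 < D + l)%N by lia.
  have lti : (i < D + l)%N by lia.
  have := sub_r _ _ (firstc (Ordinal lti) (Ordinal lt0) il l0); rewrite /= addn0.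
  by apply: dvdz_trans; apply: dvdn_gcdl.
(* The first [l] colours agree modulo [g], so they are [Delta p] plus [g] times a quotient.
   Quotients summing to [0] modulo [k] over [s] indices give a sum divisible by [s = k * g]. *)
have [|||M1 cM1 sM1] :=
    @egz_window k s l (fun i => ((Delta (p + i)%N - Delta p) %/ g%:Z)%Z).
- by [].
- by rewrite sE dvdn_mulr.
- by rewrite /l; lia.
have lt1 : (l.-1 < l)%N by lia.
pose x0 : 'I_l := Ordinal l0; pose x1 : 'I_l := Ordinal lt1.
have n01 : x0 != x1 by apply/eqP=> /(congr1 val) /=; rewrite /l; lia.
have [|U sU cU] := @exists_subset_card _ (~: [set x0; x1]) (r - 2)%N.
  have := cardsC [set x0; x1]; rewrite cards2 n01 card_ord => cC.
  by rewrite -(leq_add2l 2) cC /l; lia.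
(* Including both ends of the last [l] positions gives diameter [l - 1], the most that [S1] can have
   within the first [l]. *)
pose M2 := x0 |: (x1 |: U).
have cM2 : #|M2| = r.
  have [U0 U1] : x0 \notin U /\ x1 \notin U.
    by split; apply/negP=> /(subsetP sU); rewrite !inE eqxx ?orbT.
  rewrite !cardsU1 U1 cU !inE (negPf U0) (negPf n01) /=; lia.
exists (shift_set p M1), (shift_set (p + D) M2).
have c1 : #|` shift_set p M1| = s by rewrite card_shift_set.
have [|||||||sub lt12 diam12] := @separated_pair (5 * s + k - 4) p (p + l.-1)
  (p + D + x0) (p + D + x1) (shift_set p M1) (shift_set (p + D) M2).
- exact: nonempty.
- by rewrite /p; lia.
- by move=> _ /shift_setP[x _ ->]; have := ltn_ord x; lia.
- by move=> _ /shift_setP[x _ ->]; have := ltn_ord x; rewrite /p /D /l; lia.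
- by apply/shift_setP; exists x0; rewrite // !inE eqxx.
- by apply/shift_setP; exists x1; rewrite // !inE eqxx orbT.
- by rewrite /=; lia.
split=> //; last by rewrite !card_shift_set.
split; apply/zero_sumE; rewrite sum_shift_set.
  have -> : \sum_(i in M1) Delta (p + i)%N =
      Delta p *+ s + g%:Z * \sum_(i in M1) ((Delta (p + i)%N - Delta p) %/ g%:Z)%Z.
    rewrite -cM1 -sumr_const mulr_sumr -big_split /=; apply: eq_bigr => i _.
    by rewrite mulrC divzK ?g_dvd // addrC subrK.
  rewrite rpredD //; first by rewrite -mulr_natl natz dvdz_mulr.
  by rewrite {1}sE mulnC PoszM dvdz_mul.
apply: Zp_intr_eq0 => //; rewrite rmorph_sum /=.
have ltD : (D < D + l)%N by lia.
rewrite (eq_bigr (fun _ => c (Ordinal ltD))) => [|i _].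
  by rewrite sumr_const cM2; have := mulrn_card (c (Ordinal ltD)); rewrite {1}cV.
have ltDi : (D + i < D + l)%N by rewrite ltn_add2l.
have -> : c (Ordinal ltD) = c (Ordinal ltDi) by apply: lastc => //=; apply: leq_addr.
by rewrite /c /= addnA.
Qed.

End Upper.

(** * The block colouring and the arithmetic of its blocks *)

Definition cnt (X : seq nat) u v := count (fun x => u < x <= v) X.

Lemma cnt_le (X : seq nat) a b u v : uniq X -> (forall x, x \in X -> a <= x <= b) ->
  cnt X u v <= (minn v b).+1 - maxn u.+1 a.
Proof.
move=> uX XP; rewrite /cnt -size_filter -[leqRHS](size_iota (maxn u.+1 a)).
apply: uniq_leq_size; first exact: filter_uniq.
by move=> x; rewrite mem_filter mem_iota => /andP[xuv /XP]; lia.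
Qed.

Lemma size_cnt (X : seq nat) a1 a2 a3 a4 a5 a6 :
  a1 <= a2 <= a3 -> a3 <= a4 <= a5 -> a5 <= a6 -> (forall x, x \in X -> 0 < x <= a6) ->
  size X = cnt X 0 a1 + cnt X a1 a2 + cnt X a2 a3 + cnt X a3 a4 + cnt X a4 a5
           + cnt X a5 a6.
Proof.
move=> h1 h2 h3; elim: X => // x X IH XP.
rewrite /cnt /= -!/(cnt _ _ _) (IH _) => [|y yX]; last by rewrite XP // inE yX orbT.
by have := XP x (mem_head _ _); lia.
Qed.

Section BlockColoring.

Local Open Scope ring_scope.

Variables (q : int) (a1 a2 a3 a4 a5 : nat).

Definition block_coloring (x : nat) : int :=
  Posz ((x <= a1)%N || (a2 < x <= a5)%N) + q * Posz (a3 < x <= a4)%N.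

Lemma sum_block_coloring (X : seq nat) : (a1 <= a2 <= a3)%N -> (a3 <= a4 <= a5)%N ->
  (forall x, x \in X -> 0 < x)%N ->
  \sum_(x <- X) block_coloring x =
    Posz (cnt X 0 a1 + cnt X a2 a3 + cnt X a3 a4 + cnt X a4 a5)%N
    + q * Posz (cnt X a3 a4).
Proof.
move=> h1 h2; elim: X => [|x X IH] XP; first by rewrite big_nil /= mulr0.
rewrite big_cons IH => [|y yX]; last by rewrite XP // inE yX orbT.
rewrite /block_coloring /cnt /= -!/(cnt _ _ _).
rewrite [Posz ((a3 < x <= a4) + _)%N]PoszD mulrDr addrACA; congr (_ + _).
by have := XP x (mem_head _ _); lia.
Qed.

End BlockColoring.

Lemma cnt0 (X : seq nat) u v x : cnt X u v = 0 -> x \in X -> (u < x <= v) = false.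
Proof.
move=> c0 xX; apply/negP=> uv; have : has (fun x => u < x <= v) X by apply/hasP; exists x.
by rewrite has_count -/(cnt X u v) c0.
Qed.

(* Blocks of lengths s-k+1, s-1, s-1, k-1, s-1, s+k-2 coloured 1, 0, 1, 1+q, 1, 0,
   with n_i elements of S1 in the i-th one; [G] stands for g * n4. *)
Lemma block_arithmetic s r k g G a b n1 n2 n3 n4 n5 n6 c d a1 a2 a3 a4 a5 a6 :
  let bnd n u v := n <= (minn v b).+1 - maxn u.+1 a in
  a1 + k = s + 1 -> a2 + k = 2 * s -> a3 + k + 1 = 3 * s -> a4 + 2 = 3 * s ->
  a5 + 3 = 4 * s -> a6 + 5 = 5 * s + k ->
  1 < k -> k < s -> s <= r -> 1 < g -> G + g <= s -> G + k + g <= s + 1 + n4 ->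
  (n4 = 0 -> G = 0) -> s = n1 + n2 + n3 + n4 + n5 + n6 ->
  bnd n1 0 a1 -> bnd n2 a1 a2 -> bnd n3 a2 a3 -> bnd n4 a3 a4 -> bnd n5 a4 a5 ->
  bnd n6 a5 a6 ->
  n1 + n3 + n4 + n5 = G \/ (n4 = 0 /\ n1 + n3 + n4 + n5 = s) ->
  a2 < b /\
  (b < c -> b - a <= d - c -> r <= d.+1 - c ->
   (a5 < c /\ d <= a6) \/ d <= a5 -> False).
Proof.
move=> bnd e1 e2 e3 e4 e5 e6 k1 ks sr g1 Gs Gn4 G0 sE b1 b2 b3 b4 b5 b6 ones.
(* The dummy [unit] argument keeps [lia] from case-splitting on these implications. *)
have pos n u v : bnd n u v -> forall _ : unit, 0 < n -> a + n <= v + 1 /\ u + n <= b.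
  by rewrite /bnd => + _; clear; lia.
have len n u v : bnd n u v -> n <= v - u by rewrite /bnd; clear; lia.
have p1 := pos _ _ _ b1; have p2 := pos _ _ _ b2; have p3 := pos _ _ _ b3.
have p4 := pos _ _ _ b4; have p5 := pos _ _ _ b5; have p6 := pos _ _ _ b6.
move: (len _ _ _ b1) (len _ _ _ b2) (len _ _ _ b3) (len _ _ _ b5) (len _ _ _ b6).
move=> {b1 b2 b3 b4 b5 b6 len pos bnd} l1 l2 l3 l5 l6.
(* [w] bounds the diameter of [S1] from below. The first alternatives keep [S2] out of the last
   block: the block is too short for [w], or too little room follows [b] for [r] elements or for
   [w]. The others rule out [d <= a5] likewise. *)
suff [far bound] : a2 < b /\ exists w, [/\ a + w <= b,
    a6 < a5 + w + 1 \/ a6 < b + r \/ a6 < b + w + 1 & a5 < b + r \/ a5 < b + w + 1].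
  split=> // bc bacd rcd; case: bound => w [aw Z O] [[S2 S2']|S2].
    by clear ones G0; case: Z => [|[]]; lia.
  by clear ones G0; case: O; lia.
case: ones => [E|[E0 E]].
  case: (posnP n4) => [n40|n4p].
    (* [S1] now lies in the zero blocks; the first of them has only [s - 1] points, so [S1] meets
       the last block. *)
    have {}G0 := G0 n40; have n6p : 0 < n6 by lia.
    have [h1 h2] := p6 tt n6p; split; first by lia.
    case: (posnP n2) => [n20|n2p].
      by exists 0; split; [lia|right; left; lia|left; lia].
    have [h3 h4] := p2 tt n2p.
    by exists (2 * s + k - 2); split; [lia|left; lia|left; lia].
  have [h1 h2] := p4 tt n4p; split; first by lia.
  clear G0; case: (posnP n1) => [n10|n1p].
    case: (posnP n2) => [n20|n2p].
      have n6p : 0 < n6 by lia.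
      have [h3 h4] := p6 tt n6p.
      by exists (n4 + n6 + s - 2); split; [lia|right; right; lia|left; lia].
    have [h3 h4] := p2 tt n2p; case: (posnP n6) => [n60|n6p].
      by exists (s + k + g - 3); split; [lia|left; lia|right; lia].
    have [h5 h6] := p6 tt n6p.
    by exists (2 * s + k - 2); split; [lia|left; lia|left; lia].
  have [h3 h4] := p1 tt n1p.
  by exists (2 * s - 1); split; [lia|left; lia|right; lia].
(* [S1] now consists of [s] ones in blocks 1, 3 and 5, each of fewer than [s] points, so it meets at
   least two of them. *)
clear G0; case: (posnP n1) => [n10|n1p].
  have n3p : 0 < n3 by lia.
  have n5p : 0 < n5 by lia.
  have [h1 h2] := p3 tt n3p; have [h3 h4] := p5 tt n5p; split; first by lia.
  by exists (s + k - 2); split; [lia|left; lia|left; lia].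
have [h1 h2] := p1 tt n1p.
have bk : a2 + k <= b + 1 /\ a + (2 * s - 2) <= b.
  case: (posnP n5) => [n50|n5p]; last by have [h3 h4] := p5 tt n5p; lia.
  have n3p : 0 < n3 by lia.
  by have [h3 h4] := p3 tt n3p; lia.
case: bk => bk1 bk2; split; first by lia.
by exists (2 * s - 2); split; [lia|left; lia|right; lia].
Qed.

(** * The lower bound *)

Section Lower.

Local Open Scope ring_scope.

(** From Bezout [u r + v s = gcdn r s], take [q = - u r]. A colour [1 + q] then counts as [1] modulo
    [r] and as [1 - gcdn r s] modulo [s]. *)
Lemma crt_shift r s : exists q : int,
  (r%:Z %| q)%Z /\ (s%:Z %| q + (gcdn r s)%:Z)%Z.
Proof.
have [u [v E]] := Bezoutz r%:Z s%:Z.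
exists (- (u * r%:Z)); split; first by rewrite rpredN dvdz_mull.
have -> : (gcdn r s)%:Z = gcdz r%:Z s%:Z by [].
by rewrite -E addKr dvdz_mull.
Qed.

Lemma lower_bound r s k g m : (s <= r)%N -> (1 < k)%N -> (1 < g)%N ->
  s = (k * g)%N -> g = gcdn r s -> good s r m -> (5 * s + k - 4 <= m)%N.
Proof.
move=> sr k1 g1 sE gE Gm; rewrite leqNgt; apply/negP=> ltm.
have [q [rq sq]] := crt_shift r s; rewrite -{}gE in sq.
have ks : (k < s)%N by rewrite sE; nia.
have [a1 e1] : exists a1, (a1 + k = s + 1)%N by exists (s - k + 1)%N; lia.
have [a2 e2] : exists a2, (a2 + k = 2 * s)%N by exists (2 * s - k)%N; lia.
have [a3 e3] : exists a3, (a3 + k + 1 = 3 * s)%N by exists (3 * s - k - 1)%N; lia.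
have [a4 e4] : exists a4, (a4 + 2 = 3 * s)%N by exists (3 * s - 2)%N; lia.
have [a5 e5] : exists a5, (a5 + 3 = 4 * s)%N by exists (4 * s - 3)%N; lia.
have [a6 e6] : exists a6, (a6 + 5 = 5 * s + k)%N by exists (5 * s + k - 5)%N; lia.
have a123 : (a1 <= a2 <= a3)%N by lia.
have a345 : (a3 <= a4 <= a5)%N by lia.
have a56 : (a5 <= a6)%N by lia.
have [S1 [S2 [[sub1 sub2] [z1 z2] [c1 c2] lt12 diam12]]] :=
  Gm (block_coloring q a1 a2 a3 a4 a5).
have S1P x : x \in S1 -> (0 < x <= a6)%N.
  by move/(fsubsetP sub1); rewrite mem_interval; lia.
have S2P x : x \in S2 -> (0 < x <= a6)%N.
  by move/(fsubsetP sub2); rewrite mem_interval; lia.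
have size1 := size_cnt a123 a345 a56 S1P; have size2 := size_cnt a123 a345 a56 S2P.
rewrite -/(#|` S1|) c1 in size1; rewrite -/(#|` S2|) c2 in size2.
have pos1 x : x \in S1 -> (0 < x)%N by move/S1P/andP=> [].
have pos2 x : x \in S2 -> (0 < x)%N by move/S2P/andP=> [].
move/zero_sumE: z1; rewrite (sum_block_coloring q a123 a345 pos1).
move/zero_sumE: z2; rewrite (sum_block_coloring q a123 a345 pos2).
set A2 := (_ + cnt S2 a4 a5)%N; set A1 := (_ + cnt S1 a4 a5)%N => z2 z1.
have A2r : (r %| A2)%N.
  by move: z2; rewrite rpredDr // dvdz_mulr.
have b1 u v := @cnt_le S1 (fmin S1) (fmax S1) u v (fset_uniq S1).
have {}b1 u v : (cnt S1 u v <= (minn v (fmax S1)).+1 - maxn u.+1 (fmin S1))%N.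
  by apply: b1 => x xS; rewrite fmin_leq ?leq_fmax.
have n4k : (cnt S1 a3 a4 <= k - 1)%N.
  by apply: leq_trans (b1 _ _) _; clear -e3 e4; lia.
pose G := (g * cnt S1 a3 a4)%N.
have z1' : (s%:Z %| A1%:Z - G%:Z)%Z.
  have -> : A1%:Z - G%:Z = A1%:Z + q * (cnt S1 a3 a4)%:Z
                           - (q + g%:Z) * (cnt S1 a3 a4)%:Z.
    by rewrite /G PoszM mulrDl opprD addrA addrK.
  by rewrite rpredB // dvdz_mulr.
have GE : (G + g <= s)%N by rewrite /G sE; clear -n4k k1; move: (cnt _ _ _) n4k => n; nia.
(* [A1] and [G] are congruent modulo [s], with [A1 <= s] and [G <= s - g]; they are equal or differ
   by [s], which forces [G = 0]. *)
have ones : A1 = G \/ (cnt S1 a3 a4 = 0 /\ A1 = s)%N.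
  have leA1 : (A1 <= s)%N by rewrite /A1; clear -size1; lia.
  have G0 : G = 0%N -> cnt S1 a3 a4 = 0%N.
    by move/eqP; rewrite muln_eq0 => /orP[/eqP g0|/eqP//]; rewrite g0 in g1.
  move: (A1) (G) z1' GE leA1 G0 => A B z GE leA G0; case: (leqP B A) => [leB|ltB].
    move: z; rewrite subzn // => /dvdnP[[|t]] /= tE; first by left; clear -tE leB; lia.
    have B0 : B = 0%N by move: tE; rewrite mulSn; clear -leA GE g1 leB; lia.
    right; split; first exact: G0.
    by move: tE; rewrite mulSn; clear -leA B0; lia.
  move: z; rewrite -opprB rpredN subzn 1?ltnW // => /dvdnP[[|t]] /= tE.
    by clear -tE ltB; lia.
  by move: tE; rewrite mulSn; clear -GE g1; lia.
have [far contra] : (a2 < fmax S1)%N /\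
    ((fmax S1 < fmin S2)%N -> (fmax S1 - fmin S1 <= fmax S2 - fmin S2)%N ->
     (r <= (fmax S2).+1 - fmin S2)%N ->
     (a5 < fmin S2 /\ fmax S2 <= a6)%N \/ (fmax S2 <= a5)%N -> False).
  apply: (@block_arithmetic s r k g G _ _ (cnt S1 0 a1) (cnt S1 a1 a2)
    (cnt S1 a2 a3) (cnt S1 a3 a4) (cnt S1 a4 a5) (cnt S1 a5 a6) _ _ a1 a2 a3 a4 a5 a6)
    => //.
    (* With [n4 = cnt S1 a3 a4], this is [(k - 1 - n4) * (g - 1) >= 0]. *)
    by rewrite /G sE; clear -n4k k1 g1; move: (cnt _ _ _) n4k => n; nia.
  by rewrite /G => ->; rewrite muln0.
have nS2 : S2 != fset0%fset by rewrite -cardfs_gt0 c2; clear -sr ks; lia.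
have S2b x : x \in S2 -> (a2 < x)%N.
  by move=> xS; apply: ltn_trans far (leq_trans lt12 (fmin_leq xS)).
apply: contra => //.
- by rewrite -c2 card_le_span.
(* [r] divides [A2] and [#|S2| = r]: either [S2] avoids the blocks with ones and, being beyond [a2],
   lies in the last block, or it lies wholly in those blocks and ends by [a5]. *)
- have [A20|A2p] := posnP A2; [left|right].
    split; last by apply: fmax_leq => x /S2P/andP[].
    apply: leq_fmin => // x xS; rewrite ltnNge; apply/negP=> xa5.
    have [x3 [x4 x5]] : cnt S2 a2 a3 = 0%N /\ cnt S2 a3 a4 = 0%N /\ cnt S2 a4 a5 = 0%N.
      by move: A20; rewrite /A2; clear; lia.
    have := cnt0 x3 xS; have := cnt0 x4 xS; have := cnt0 x5 xS; have := S2b x xS.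
    by clear -xa5 a345; lia.
  have rA2 := dvdn_leq A2p A2r.
  have c6 : cnt S2 a5 a6 = 0%N by move: size2 rA2; rewrite /A2; clear; lia.
  apply: fmax_leq => x xS; have := cnt0 c6 xS; have := S2P x xS; clear; lia.
Qed.

End Lower.

Theorem theorem3p7 (r s : nat) (hs : 3 <= s) (hrs : s <= r)
    (hr : r <= 2 * s - 2) (hg : 1 < gcdn r s)
    (h : r < s + s %/ gcdn r s - 1) :
  is_f s r (5 * s + s %/ gcdn r s - 4).
Proof.
have sE : s = s %/ gcdn r s * gcdn r s by rewrite divnK ?dvdn_gcdr.
move: (s %/ gcdn r s) sE h => k sE h.
have k1 : 1 < k by clear -hrs h; lia.
have ks : k < s by rewrite [ltnRHS]sE; move: (gcdn r s) hg => g; clear -k1; nia.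
split=> [||m _]; first by clear -hs; lia.
  exact: upper_bound.
exact: (@lower_bound r s k (gcdn r s)).
Qed.
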